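(* Let $U$ be a nonempty finite set and $\mathcal{B}$ a Boolean sublattice of $\mathrm{Part}(U)$. (i) If $\nabla\notin\mathcal{B}$, then $\mathcal{B}$ is contained in a strictly larger Boolean sublattice $\mathcal{B}'$ of $\mathrm{Part}(U)$. (ii) If $\nabla\in\mathcal{B}$ but $\triangle\notin\mathcal{B}$, then $\mathcal{B}$ is contained in a strictly larger Boolean sublattice $\mathcal{B}'$ of $\mathrm{Part}(U)$.
   Context: $\mathrm{Part}(U)$ is the lattice of all partitions of $U$ ordered by refinement; $\triangle$ is its least element (all blocks singletons) and $\nabla$ its greatest element (single block $U$). A Boolean sublattice of $\mathrm{Part}(U)$ is a sublattice (closed under meet and join of $\mathrm{Part}(U)$) that is itself a Boolean lattice with respect to its own least and greatest elements, which need not be $\triangle$ and $\nabla$. *)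

(* Defs.v *)
From HB Require Import structures.
From mathcomp Require Import all_boot all_order.

Set Implicit Arguments.
Unset Strict Implicit.
Unset Printing Implicit Defensive.

Import Order.TTheory.

Record Part (U : finType) := MkPart {
  blocks :> {set {set U}};
  blocksP : partition blocks [set: U]
}.

Section PartFinite.

Variable U : finType.

HB.instance Definition _ := [isSub for @blocks U].
HB.instance Definition _ := [Finite of Part U by <:].

End PartFinite.

Fact Part_display : Order.disp_t. Proof. exact: Order.Disp tt tt. Qed.

Section PartLattice.

Variable U : finType.
Implicit Types (P Q R : Part U) (x y z : U).

Definition same_block P : rel U := fun x y => y \in pblock P x.

Definition part_le P Q :=
  [forall A in blocks P, exists B in blocks Q, A \subset B].

(* The equivalence relation of the join is the transitive closure of the union
   of the two equivalence relations. *)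
Definition join_rel P Q : rel U :=
  connect (fun x y => same_block P x y || same_block Q x y).

Definition meet_blocks P Q : {set {set U}} :=
  [set A :&: B | A in blocks P, B in blocks Q] :\ set0.

Definition join_blocks P Q : {set {set U}} :=
  equivalence_partition (join_rel P Q) [set: U].

Definition bottom_blocks : {set {set U}} := [set [set x] | x : U].

(* Removing set0 only matters when U is empty, where the unique partition has
   no block; see blocks_top. *)
Definition top_blocks : {set {set U}} := [set [set: U]] :\ set0.

Lemma block_cover P x : x \in cover P.
Proof. by rewrite (cover_partition (blocksP P)) inE. Qed.

Lemma block_triv P : trivIset P.
Proof. by case/and3P: (blocksP P). Qed.

Lemma block_neq0 P : set0 \in blocks P = false.
Proof. exact: partition0 (blocksP P). Qed.

Lemma pblock_in P x : pblock P x \in blocks P.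
Proof. by rewrite pblock_mem ?block_cover. Qed.

Lemma same_block_refl P x : same_block P x x.
Proof. by rewrite /same_block mem_pblock block_cover. Qed.

Lemma same_blockE P x y : same_block P x y = (pblock P x == pblock P y).
Proof. by rewrite eq_pblock ?block_triv ?block_cover. Qed.

Lemma same_block_sym P x y : same_block P x y = same_block P y x.
Proof. by rewrite !same_blockE eq_sym. Qed.

Lemma same_block_trans P y x z :
  same_block P x y -> same_block P y z -> same_block P x z.
Proof. by rewrite !same_blockE => /eqP-> /eqP->. Qed.

Lemma same_block_mem P A x y :
  A \in blocks P -> x \in A -> same_block P x y = (y \in A).
Proof. by move=> PA Ax; rewrite /same_block (def_pblock (block_triv P) PA Ax). Qed.

Lemma part_leP P Q :
  reflect (forall x y, same_block P x y -> same_block Q x y) (part_le P Q).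
Proof.
apply: (iffP forall_inP) => [le_PQ x y Pxy | le_PQ A PA].
  have /exists_inP[B QB sAB] := le_PQ _ (pblock_in P x).
  rewrite (@same_block_mem Q B) ?(subsetP sAB) //.
  exact: same_block_refl.
have /set0Pn[x Ax] : A != set0 by apply: contraTneq PA => ->; rewrite block_neq0.
apply/exists_inP; exists (pblock Q x); first exact: pblock_in.
by apply/subsetP=> y Ay; apply: le_PQ; rewrite (same_block_mem _ PA Ax).
Qed.

Lemma same_block_inj P Q : same_block P =2 same_block Q -> P = Q.
Proof.
move=> eqPQ; apply: val_inj => /=.
rewrite -(equivalence_partition_pblock (blocksP P)).
rewrite -(equivalence_partition_pblock (blocksP Q)).
apply: eq_imset => x; apply/setP => y; rewrite !inE.
exact: eqPQ.
Qed.

Fact part_le_refl : reflexive part_le.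
Proof. by move=> P; apply/part_leP. Qed.

Fact part_le_anti : antisymmetric part_le.
Proof.
move=> P Q /andP[/part_leP lePQ /part_leP leQP].
by apply: same_block_inj => x y; apply/idP/idP => [/lePQ | /leQP].
Qed.

Fact part_le_trans : transitive part_le.
Proof.
move=> Q P R /part_leP lePQ /part_leP leQR.
by apply/part_leP => x y /lePQ /leQR.
Qed.

Fact meet_blocksP P Q : partition (meet_blocks P Q) [set: U].
Proof.
apply/and3P; split; last by rewrite !inE eqxx.
  rewrite -subTset; apply/subsetP=> x _; apply/bigcupP.
  have xPQ : x \in pblock P x :&: pblock Q x.
    by rewrite inE; apply/andP; split; apply: same_block_refl.
  exists (pblock P x :&: pblock Q x) => //.
  rewrite !inE imset2_f ?pblock_in // andbT.
  by apply/set0Pn; exists x.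
apply/trivIsetP => X Y /setD1P[_ /imset2P[A B PA QB ->]].
move=> /setD1P[_ /imset2P[A' B' PA' QB' ->]]; apply: contraR.
case/pred0Pn=> x /= /andP[/setIP[Ax Bx] /setIP[A'x B'x]].
rewrite -(def_pblock (block_triv P) PA Ax) -(def_pblock (block_triv P) PA' A'x).
by rewrite -(def_pblock (block_triv Q) QB Bx) -(def_pblock (block_triv Q) QB' B'x).
Qed.

Definition part_meet P Q := MkPart (meet_blocksP P Q).

Lemma same_block_meet P Q x y :
  same_block (part_meet P Q) x y = same_block P x y && same_block Q x y.
Proof.
rewrite (@same_block_mem _ (pblock P x :&: pblock Q x)) ?inE //.
  rewrite imset2_f ?pblock_in // andbT.
  by apply/set0Pn; exists x; rewrite inE; apply/andP; split; apply: same_block_refl.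
by apply/andP; split; apply: same_block_refl.
Qed.

Lemma join_rel_equiv P Q : {in [set: U] & &, equivalence_rel (join_rel P Q)}.
Proof.
have symR : connect_sym (fun x y => same_block P x y || same_block Q x y).
  by apply: sym_connect_sym => x y; rewrite !(same_block_sym _ x).
move=> x y z _ _ _; split; first exact: connect0.
by move=> xy; apply: (same_connect symR xy).
Qed.

Fact join_blocksP P Q : partition (join_blocks P Q) [set: U].
Proof. exact: (equivalence_partitionP (@join_rel_equiv P Q)). Qed.

Definition part_join P Q := MkPart (join_blocksP P Q).

Lemma same_block_join P Q x y :
  same_block (part_join P Q) x y = join_rel P Q x y.
Proof.
by apply: (pblock_equivalence_partition (@join_rel_equiv P Q)); rewrite inE.
Qed.

Fact part_meetP P Q R : part_le P (part_meet Q R) = part_le P Q && part_le P R.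
Proof.
apply/part_leP/andP => [le_P | [/part_leP lePQ /part_leP lePR] x y Pxy].
  by split; apply/part_leP => x y /le_P; rewrite same_block_meet => /andP[].
by rewrite same_block_meet lePQ ?lePR.
Qed.

Fact part_joinP P Q R : part_le (part_join P Q) R = part_le P R && part_le Q R.
Proof.
apply/part_leP/andP => [le_R | [/part_leP lePR /part_leP leQR] x y].
  by split; apply/part_leP => x y xy; apply: le_R;
     rewrite same_block_join; apply: connect1; rewrite xy ?orbT.
rewrite same_block_join => /connectP[p + ->]; elim: p x => [|z p IHp] x /=.
  by move=> _; apply: same_block_refl.
case/andP=> xz pzp; apply: (same_block_trans _ (IHp z pzp)).
by case/orP: xz => [/lePR | /leQR].
Qed.

Fact bottom_blocksP : partition bottom_blocks [set: U].
Proof.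
apply/and3P; split.
- rewrite -subTset; apply/subsetP=> x _; apply/bigcupP.
  by exists [set x]; rewrite ?imset_f ?inE.
- apply/trivIsetP => _ _ /imsetP[x _ ->] /imsetP[y _ ->] neq_xy.
  by rewrite disjoints1 inE; apply: contraNneq neq_xy => ->.
- by apply/imsetP => -[x _ /setP/(_ x)]; rewrite !inE eqxx.
Qed.

Fact top_blocksP : partition top_blocks [set: U].
Proof.
apply/and3P; split; last by rewrite !inE eqxx.
  rewrite -subTset; apply/subsetP=> x _; apply/bigcupP.
  exists [set: U]; rewrite ?inE // eqxx andbT.
  by apply/set0Pn; exists x; rewrite inE.
by apply/trivIsetP => A B; rewrite !inE => /andP[_ /eqP->] /andP[_ /eqP->]; rewrite eqxx.
Qed.

Definition part_bottom := MkPart bottom_blocksP.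
Definition part_top := MkPart top_blocksP.

Fact part_le0x P : part_le part_bottom P.
Proof.
apply/part_leP => x y; rewrite (@same_block_mem _ [set x]) ?inE ?imset_f //.
by move/eqP->; apply: same_block_refl.
Qed.

Fact part_lex1 P : part_le P part_top.
Proof.
apply/part_leP => x y _; rewrite (@same_block_mem _ [set: U]) ?inE //.
by rewrite eqxx andbT; apply/set0Pn; exists x; rewrite inE.
Qed.

HB.instance Definition _ := Order.Le_isPOrder.Build Part_display (Part U)
  part_le_refl part_le_anti part_le_trans.
HB.instance Definition _ := Order.POrder_MeetJoin_isLattice.Build
  Part_display (Part U) part_meetP part_joinP.
HB.instance Definition _ :=
  Order.hasBottom.Build Part_display (Part U) part_le0x.
HB.instance Definition _ :=
  Order.hasTop.Build Part_display (Part U) part_lex1.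

Lemma blocks_bottom : blocks (\bot%O : Part U) = [set [set x] | x : U].
Proof. by []. Qed.

Lemma blocks_top : 0 < #|U| -> blocks (\top%O : Part U) = [set [set: U]].
Proof.
case/card_gt0P=> x _; apply/setDidPl; rewrite disjoints1 inE.
by apply/set0Pn; exists x; rewrite inE.
Qed.

End PartLattice.

(* The bounds o and i are those of B itself, not those of L. *)
Definition boolean_sublattice (d : Order.disp_t) (L : finLatticeType d)
    (B : {set L}) : Prop :=
  [/\ meet_closed B,
      join_closed B,
      {in B & &, forall x y z, (x `|` y) `&` z = (x `&` z) `|` (y `&` z)}%O
    & exists o i : L,
        [/\ o \in B, i \in B, {in B, forall x, o <= x <= i}%O
          & {in B, forall x, exists2 y, y \in B
                                      & (x `&` y = o)%O /\ (x `|` y = i)%O}]].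

(* Main.v *)
(** In both parts [B] is enlarged to the image of [bool * B] under a map
    [g : bool -> Part U -> Part U] that is compatible with meets and joins; such
    an image is again Boolean. Write [o] and [i] for the bounds of [B].

    (i) Let [T] be a transversal of the blocks of [i], and let [P] be the
    partition whose only possibly nontrivial block is [T]. Take [g false x = x]
    and [g true x = x `|` P]. Since [T] meets every block of [i] once, joining
    with [P] creates no new relation inside a block of [i]; this gives the meet
    identities. The new top is [i `|` P], which is the partition with one block.

    (ii) Let [a <> c] lie in a common block of [o], and let [P] be the partition
    into [{a}] and its complement. Take [g true x = x] and [g false x = P `&` x].
    A chain of related points that passes through [a] can be rerouted through
    [c]; this gives the join identities. The new bottom [P `&` o] lies strictly
    below [o]. *)

Require Import Defs.
From mathcomp Require Import all_boot all_order.

Set Implicit Arguments.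
Unset Strict Implicit.
Unset Printing Implicit Defensive.

Import Order.TTheory.
Local Open Scope order_scope.

(** The two identities make [g] a lattice homomorphism on the product of the two-element Boolean
    lattice with [B], so distributivity, bounds and complements carry over coordinatewise. *)
Lemma boolean_sublattice_bool_image (d : Order.disp_t) (L : finLatticeType d)
    (B : {set L}) (g : bool -> L -> L) :
  boolean_sublattice B ->
  {in B &, forall x y a b, g a x `&` g b y = g (a && b) (x `&` y)} ->
  {in B &, forall x y a b, g a x `|` g b y = g (a || b) (x `|` y)} ->
  boolean_sublattice [set g a x | a in [set: bool], x in B].
Proof.
move=> [Bmeet Bjoin Bdistr [o [i [Bo Bi Bbnd Bcompl]]]] gmeet gjoin.
have Bg a x : x \in B -> g a x \in [set g a x | a in [set: bool], x in B].
  by move=> Bx; apply: imset2_f; rewrite ?inE.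
split.
- move=> _ _ /imset2P[a x _ Bx ->] /imset2P[b y _ By ->].
  by rewrite gmeet // Bg ?Bmeet.
- move=> _ _ /imset2P[a x _ Bx ->] /imset2P[b y _ By ->].
  by rewrite gjoin // Bg ?Bjoin.
- move=> _ _ _ /imset2P[a x _ Bx ->] /imset2P[b y _ By ->] /imset2P[c z _ Bz ->].
  by rewrite gjoin // !gmeet ?Bjoin // gjoin ?Bmeet // Bdistr // andb_orl.
exists (g false o), (g true i); split; rewrite ?Bg //.
  move=> _ /imset2P[a x _ Bx ->]; have /andP[ox xi] := Bbnd x Bx.
  by rewrite !leEmeet !gmeet // andbT (meet_l ox) (meet_l xi) !eqxx.
move=> _ /imset2P[a x _ Bx ->]; have [y By [xy0 xy1]] := Bcompl x Bx.
exists (g (~~ a) y); first exact: Bg.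
by rewrite gmeet // gjoin // andbN orbN xy0 xy1.
Qed.

(** * Partitions as equivalence relations *)

Section Partitions.

Variable U : finType.
Implicit Types (P Q R : Part U) (T : {set U}) (x y z t : U).

Lemma part_of_equivalence (e : rel U) :
  equivalence_rel e -> exists P, same_block P =2 e.
Proof.
move=> e_equiv.
have eqv : {in [set: U] & &, equivalence_rel e} by move=> x y z _ _ _; apply: e_equiv.
exists (MkPart (equivalence_partitionP eqv)) => x y.
by apply: (pblock_equivalence_partition eqv); rewrite inE.
Qed.

Lemma same_block_meetE P Q x y :
  same_block (P `&` Q) x y = same_block P x y && same_block Q x y.
Proof. exact: same_block_meet. Qed.

Lemma le_same_block P Q x y : P <= Q -> same_block P x y -> same_block Q x y.
Proof. by move=> /part_leP; apply. Qed.

(** The join is connectivity under the union of the two relations, so induction along a path bounds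
    it by any preorder containing both. *)
Lemma same_block_join_ind (e : rel U) P Q :
  reflexive e -> transitive e ->
  subrel (same_block P) e -> subrel (same_block Q) e ->
  subrel (same_block (P `|` Q)) e.
Proof.
move=> e_refl e_trans Pe Qe x y; rewrite [same_block _ _ _]same_block_join.
case/connectP=> p + ->; elim: p x => [|z p IHp] x //= /andP[xz /IHp].
by apply: e_trans; case/orP: xz => [/Pe | /Qe].
Qed.

Lemma part_transversal P :
  exists T, (forall x, exists2 t, t \in T & same_block P x t) /\
            {in T &, forall t t', same_block P t t' -> t = t'}.
Proof.
(* [r] depends only on the block: the default is never reached, since the block of [x] contains
   [x]. *)
pose r x := odflt x [pick y in pblock P x].
have Pr x : same_block P x (r x).
  rewrite /r; case: pickP => //= _; exact: same_block_refl.
have r_eq x y : same_block P x y -> r x = r y.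
  rewrite same_blockE /r => /eqP <-; case: pickP => // /(_ x).
  by rewrite [_ \in _]same_block_refl.
exists [set r x | x : U]; split=> [x | _ _ /imsetP[x _ ->] /imsetP[y _ ->] xy].
  by exists (r x); rewrite ?imset_f.
apply: r_eq; apply: same_block_trans (Pr x) _; apply: same_block_trans xy _.
by rewrite same_block_sym.
Qed.

Lemma part_one_block T :
  exists P, forall x y, same_block P x y = (x == y) || (x \in T) && (y \in T).
Proof.
apply: (@part_of_equivalence (fun x y => (x == y) || (x \in T) && (y \in T))).
move=> x y z; rewrite eqxx; split=> //.
case: (x =P y) => [-> // | _] /andP[Tx Ty]; rewrite Tx Ty /=.
have TU u : u \in T -> (u == z) || (z \in T) = (z \in T).
  by case: (u =P z) => [<- -> |].
by rewrite !TU.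
Qed.

Lemma part_point a : exists P, forall x y, same_block P x y = ((x == a) == (y == a)).
Proof.
apply: part_of_equivalence => x y z; split=> //.
by move=> /eqP->.
Qed.

(** A path can leave a block of [Q] only through [T]. *)
Lemma same_block_join_one_block T P Q x y :
  (forall u v, same_block P u v = (u == v) || (u \in T) && (v \in T)) ->
  same_block (Q `|` P) x y ->
  same_block Q x y \/ exists t t', [/\ t \in T, t' \in T, same_block Q x t
                                     & same_block Q y t'].
Proof.
(* [s u] says that the [Q]-block of [u] meets [T]; being [Q]-related or both satisfying [s] is a
   preorder containing [Q] and [P]. *)
move=> PE; pose s u := [exists t in T, same_block Q u t].
have sQ u v : same_block Q u v -> s v -> s u.
  move=> uv /exists_inP[t Tt vt]; apply/exists_inP; exists t => //.
  exact: same_block_trans vt.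
move=> xy; have : same_block Q x y || s x && s y.
  move: x y xy; apply: same_block_join_ind => [u | v u w | u v -> // | u v].
  - by rewrite same_block_refl.
  - case/orP=> [uv /orP[vw | /andP[sv sw]] | /andP[su sv] /orP[vw | /andP[_ sw]]].
    + by rewrite (same_block_trans uv vw).
    + by rewrite (sQ u v) ?sw ?orbT.
    + by rewrite su (sQ w v) ?orbT // same_block_sym.
    + by rewrite su sw orbT.
  rewrite PE => /orP[/eqP-> | /andP[Tu Tv]]; first by rewrite same_block_refl.
  by apply/orP; right; apply/andP; split; apply/exists_inP;
     [exists u | exists v]; rewrite ?same_block_refl.
case/orP=> [| /andP[/exists_inP[t Tt xt] /exists_inP[t' Tt' yt']]]; first by left.
by right; exists t, t'.
Qed.

(** * Joining with a transversal block *)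

Section TransversalBlock.

Variables (I P : Part U) (T : {set U}).
Hypothesis T_inj : {in T &, forall t t', same_block I t t' -> t = t'}.
Hypothesis PE : forall x y, same_block P x y = (x == y) || (x \in T) && (y \in T).

(** If [R] relates [x] and [y], a detour between them through [T] enters and leaves at points of one
    block of [I]. These points coincide, so [Q] already relates [x] and [y]. *)
Lemma meet_join_transversal Q R : Q <= I -> R <= I -> (Q `|` P) `&` R = Q `&` R.
Proof.
move=> QI RI; apply/le_anti/andP; split; last by rewrite leI2 ?leUl.
apply/part_leP => x y.
rewrite !same_block_meetE => /andP[/(same_block_join_one_block PE) QPxy Rxy].
rewrite Rxy andbT; case: QPxy => // -[t [t' [Tt Tt' xt yt']]].
have tt' : t = t'.
  apply: T_inj => //; apply: same_block_trans (le_same_block QI yt').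
  apply: same_block_trans (le_same_block RI Rxy).
  by rewrite same_block_sym (le_same_block QI).
by apply: same_block_trans xt _; rewrite tt' same_block_sym.
Qed.

Lemma meet_join2_transversal Q R :
  Q <= I -> R <= I -> (Q `|` P) `&` (R `|` P) = (Q `&` R) `|` P.
Proof.
move=> QI RI; apply/le_anti/andP; split; last by rewrite lexI !leU2 ?leIl ?leIr.
apply/part_leP => x y; rewrite same_block_meetE => /andP[QPxy RPxy].
have leQR : Q `&` R <= Q `&` R `|` P by apply: leUl.
case: (same_block_join_one_block PE QPxy) => [Qxy | [t [t' [Tt Tt' Qxt Qyt']]]].
  apply: le_same_block leQR _; rewrite meetC -meet_join_transversal //.
  by rewrite same_block_meetE RPxy.
case: (same_block_join_one_block PE RPxy) => [Rxy | [u [u' [Tu Tu' Rxu Ryu']]]].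
  apply: le_same_block leQR _; rewrite -meet_join_transversal //.
  by rewrite same_block_meetE QPxy.
(* Both joins now use a detour. From a common endpoint, [Q] and [R] reach [T] within one block of
   [I], hence at the same point, so the two detours agree. *)
have T_inj2 z v w : v \in T -> w \in T -> same_block Q z v -> same_block R z w -> v = w.
  move=> Tv Tw zv zw; apply: T_inj => //.
  apply: same_block_trans (le_same_block RI zw).
  by rewrite same_block_sym (le_same_block QI).
have tu := T_inj2 x t u Tt Tu Qxt Rxu; have tu' := T_inj2 y t' u' Tt' Tu' Qyt' Ryu'.
subst u u'; apply: (@same_block_trans _ _ t).
  by apply: le_same_block leQR _; rewrite same_block_meetE Qxt.
apply: (@same_block_trans _ _ t').
  by apply: le_same_block (leUr _ _) _; rewrite PE Tt Tt' orbT.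
by apply: le_same_block leQR _; rewrite same_block_sym same_block_meetE Qyt'.
Qed.

End TransversalBlock.

Lemma join_transversal_eq1 P Q T :
  (forall x, exists2 t, t \in T & same_block Q x t) ->
  (forall x y, same_block P x y = (x == y) || (x \in T) && (y \in T)) ->
  Q `|` P = \top.
Proof.
move=> T_meets PE; apply: le_anti; rewrite lex1; apply/part_leP => x y _.
have [[t Tt xt] [t' Tt' yt']] := (T_meets x, T_meets y).
apply: same_block_trans (le_same_block (leUl _ _) xt) _.
apply: (@same_block_trans _ _ t').
  by apply: le_same_block (leUr _ _) _; rewrite PE Tt Tt' orbT.
by apply: le_same_block (leUl _ _) _; rewrite same_block_sym.
Qed.

(** * Meeting with a partition that isolates a point *)

Section IsolatedPoint.

Variables (O P : Part U) (a c : U).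
Hypothesis ac : c != a.
Hypothesis Oac : same_block O a c.
Hypothesis PE : forall x y, same_block P x y = ((x == a) == (y == a)).

(** The rerouting map: it avoids [a], so [P] relates all its values, and it preserves every block of
    a partition above [O]. *)
Let s x := if x == a then c else x.

Lemma same_block_reroute Q x : O <= Q -> same_block Q x (s x).
Proof.
move=> OQ; rewrite /s; case: eqP => [-> | _]; last exact: same_block_refl.
exact: le_same_block Oac.
Qed.

Lemma same_block_meet_reroute Q x y :
  O <= Q -> same_block Q x y -> same_block (P `&` Q) (s x) (s y).
Proof.
move=> OQ xy; rewrite same_block_meetE PE.
have sa z : (s z == a) = false.
  by rewrite /s; case: ifP => // _; apply: negbTE.
rewrite !sa /=; apply: same_block_trans (same_block_reroute y OQ).
by apply: same_block_trans xy; rewrite same_block_sym same_block_reroute.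
Qed.

(** Follow [x], [s x], [s y], [y]: [R] provides the outer steps. Each middle step, if [Q] relates
    [x] and [y], survives the meet with [P]. *)
Lemma join_meet_point Q R : O <= Q -> O <= R -> (P `&` Q) `|` R = Q `|` R.
Proof.
move=> OQ OR; apply/le_anti/andP; split; first by rewrite leU2 ?leIr.
rewrite leUx leUr andbT.
apply/part_leP => x y xy.
have toR z : same_block (P `&` Q `|` R) z (s z).
  exact: le_same_block (leUr _ _) (same_block_reroute z OR).
apply: same_block_trans (toR x) _.
apply: (@same_block_trans _ _ (s y)); last by rewrite same_block_sym.
exact: le_same_block (leUl _ _) (same_block_meet_reroute OQ xy).
Qed.

Lemma join_meet2_point Q R :
  O <= Q -> O <= R -> (P `&` Q) `|` (P `&` R) = P `&` (Q `|` R).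
Proof.
move=> OQ OR; apply/le_anti/andP; split; first by rewrite leUx !leI2 ?leUl ?leUr.
apply/part_leP => x y.
set J := (P `&` Q) `|` (P `&` R); rewrite same_block_meetE PE => /andP[xy QRxy].
have: same_block J (s x) (s y).
  move: x y QRxy {xy}.
  apply: (@same_block_join_ind (fun u v => same_block J (s u) (s v))) => [x | y x z | x y | x y].
  - exact: same_block_refl.
  - exact: same_block_trans.
  - by move/(same_block_meet_reroute OQ); apply: le_same_block; rewrite /J leUl.
  - by move/(same_block_meet_reroute OR); apply: le_same_block; rewrite /J leUr.
(* As [P] relates [x] and [y], either both equal [a] or both are fixed by [s]. *)
move: xy; rewrite /s; case: (eqVneq x a) => [-> | _]; case: (eqVneq y a) => [-> | _] //.
by rewrite !same_block_refl.
Qed.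

End IsolatedPoint.

Lemma part_neq0_same_block P : P != \bot -> exists a c, c != a /\ same_block P a c.
Proof.
move=> P0; have : [exists a, exists c, (c != a) && same_block P a c].
  apply: contraR P0 => /existsPn noP; rewrite -lex0; apply/part_leP => x y Pxy.
  have /existsPn/(_ y) := noP x; rewrite Pxy andbT negbK => /eqP->.
  exact: same_block_refl.
by case/existsP=> a /existsP[c /andP[]]; exists a, c.
Qed.

(** * The two extensions *)

Lemma boolean_sublattice_extend_top (B : {set Part U}) :
  boolean_sublattice B -> \top \notin B ->
  exists B' : {set Part U}, boolean_sublattice B' /\ B \proper B'.
Proof.
move=> Bbool; have [_ _ _ [o [i [_ Bi bnd _]]]] := Bbool => top_notin.
have le_i Q : Q \in B -> Q <= i by move=> /bnd/andP[].
have [T [T_meets T_inj]] := part_transversal i.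
have [P PE] := part_one_block T.
pose g b Q := if b then Q `|` P else Q.
exists [set g b Q | b in [set: bool], Q in B]; split.
  (* Only the meets involving [P] need the transversal; the joins are rearrangements. *)
  apply: boolean_sublattice_bool_image => // x y /le_i xi /le_i yi [] [] //=.
  - exact: meet_join2_transversal PE _ _ xi yi.
  - exact: meet_join_transversal PE _ _ xi yi.
  - by rewrite meetC (meet_join_transversal T_inj PE yi xi) meetC.
  - by rewrite joinACA joinxx.
  - by rewrite joinAC.
  - by rewrite joinA.
apply/properP; split.
  by apply/subsetP => x Bx; apply/imset2P; exists false x; rewrite ?inE.
exists \top => //; apply/imset2P; exists true i; rewrite ?inE //=.
by rewrite (join_transversal_eq1 T_meets PE).
Qed.

Lemma boolean_sublattice_extend_bottom (B : {set Part U}) :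
  boolean_sublattice B -> \bot \notin B ->
  exists B' : {set Part U}, boolean_sublattice B' /\ B \proper B'.
Proof.
move=> Bbool; have [_ _ _ [o [i [Bo _ bnd _]]]] := Bbool => bot_notin.
have ge_o Q : Q \in B -> o <= Q by move=> /bnd/andP[].
have o_neq0 : o != \bot by apply: contraNneq bot_notin => <-.
have [a [c [ac oac]]] := part_neq0_same_block o_neq0.
have [P PE] := part_point a.
pose g b Q := if b then Q else P `&` Q.
exists [set g b Q | b in [set: bool], Q in B]; split.
  apply: boolean_sublattice_bool_image => // x y /ge_o xo /ge_o yo [] [] //=.
  - by rewrite meetCA.
  - by rewrite meetA.
  - by rewrite meetACA meetxx.
  - by rewrite joinC (join_meet_point ac oac PE yo xo) joinC.
  - exact: join_meet_point ac oac PE _ _ xo yo.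
  - exact: join_meet2_point ac oac PE _ _ xo yo.
apply/properP; split.
  by apply/subsetP => x Bx; apply/imset2P; exists true x; rewrite ?inE.
exists (P `&` o); first by apply/imset2P; exists false o; rewrite ?inE.
(* Membership in [B] would put [o] below [P], but [P] separates [a] from [c]. *)
apply/negP => /ge_o oP; have := le_same_block oP oac.
by rewrite same_block_meetE PE eqxx (negbTE ac).
Qed.

End Partitions.

Local Close Scope order_scope.

Theorem proposition2p2 (U : finType) (U_nonempty : 0 < #|U|)
    (B : {set Part U}) (B_boolean : boolean_sublattice B) :
  ((\top%O : Part U) \notin B ->
     exists B' : {set Part U}, boolean_sublattice B' /\ B \proper B') /\
  ((\top%O : Part U) \in B -> (\bot%O : Part U) \notin B ->
     exists B' : {set Part U}, boolean_sublattice B' /\ B \proper B').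
Proof.
split=> [|_]; first exact: boolean_sublattice_extend_top.
exact: boolean_sublattice_extend_bottom.
Qed.
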